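(* For any non-negative integer $n$, there exists a virtual knot $K$ whose unknotting index is $U(K)=(0,n)$.
   Context: Virtual knots. A virtual knot diagram is a generic immersion of an oriented circle into the plane whose finitely many transverse double points are each either a real crossing (equipped with over/under information) or a virtual crossing (marked by a small circle, with no over/under information). The word ''crossing'' without qualifier means real crossing. A virtual knot is an equivalence class of such diagrams under planar isotopy, the classical Reidemeister moves RI, RII, RIII (on real crossings), the virtual moves VRI, VRII, VRIII (the same moves with all crossings virtual), and the mixed move VRIV (an arc all of whose crossings in the move are virtual is moved across a real crossing). The trivial knot is the virtual knot presented by a diagram with no crossings. Unknotting index. For non-negative integers $m,n$, a diagram $D$ is $(m,n)$-unknottable if $D$ is changed into a diagram of the trivial knot by changing $m$ real crossings of $D$ into virtual crossings and applying crossing changes (switching over and under) on $n$ real crossings of $D$. $U(D)$ is the minimum, with respect to the dictionary (lexicographic) order, of all pairs $(m,n)$ such that $D$ is $(m,n)$-unknottable; $U(K)$ is the minimum (in the dictionary order) of $U(D)$ over all diagrams $D$ presenting $K$. *)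

(* Defs.v *)
From Stdlib Require Import Relation_Operators.
From mathcomp Require Import all_boot all_order.

Set Implicit Arguments.
Unset Strict Implicit.
Unset Printing Implicit Defensive.

Import Order.TTheory.

(* Plane diagrams are encoded in general position with respect to the height
   function of the plane.  Such a diagram is cut by horizontal lines into slabs,
   each containing exactly one local minimum, local maximum or double point,
   besides vertical strands; it is the word of these elementary pieces, read
   from bottom to top.  The strands met by a horizontal line are numbered from
   0 on the left. *)

(* [Real b]: the over strand is the one going from bottom left to top right
   if [b], the one going from bottom right to top left otherwise. *)
Inductive crossing := Real of bool | Virtual.

(* [Cup up]: local minimum, whose left end is oriented upwards iff [up]. *)
Inductive shape := Cup of bool | Cap | Cross of crossing.

(* A shape together with the number of strands to its left. *)
Definition piece := (nat * shape)%type.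
Definition word := seq piece.

Definition bottom_ends (g : shape) : nat := if g is Cup _ then 0 else 2.
Definition top_ends (g : shape) : nat := if g is Cap then 0 else 2.

Definition insert2 T (i : nat) (x y : T) (s : seq T) : seq T :=
  take i s ++ x :: y :: drop i s.
Definition remove2 T (i : nat) (s : seq T) : seq T :=
  take i s ++ drop i.+2 s.
Definition swap2 T (x0 : T) (i : nat) (s : seq T) : seq T :=
  insert2 i (nth x0 s i.+1) (nth x0 s i) (remove2 i s).

(* The orientations ([true] = upwards) of the strands on the line above a
   piece, from those on the line below; [None] if the piece does not fit. *)
Definition step (s : seq bool) (p : piece) : option (seq bool) :=
  let: (i, g) := p in
  match g with
  | Cup up => if i <= size s then Some (insert2 i up (~~ up) s) else None
  | Cap => if (i.+1 < size s) && (nth true s i != nth true s i.+1)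
           then Some (remove2 i s) else None
  | Cross _ => if i.+1 < size s then Some (swap2 true i s) else None
  end.

Definition run (s : seq bool) (w : word) : option (seq bool) :=
  foldl (fun o p => obind (step^~ p) o) (Some s) w.

(* Number of closed components of the immersed curve: [s] labels the strands on
   the current line by the component built so far that contains them, and
   [fresh] is the next unused label.  A local maximum either closes up a
   component or merges two partial ones. *)
Fixpoint components_from (fresh : nat) (s : seq nat) (w : word) : nat :=
  match w with
  | [::] => 0
  | (i, Cup _) :: w' => components_from fresh.+1 (insert2 i fresh fresh s) w'
  | (i, Cap) :: w' =>
      let a := nth 0 s i in
      let b := nth 0 s i.+1 in
      (a == b)
      + components_from fresh [seq if c == b then a else c | c <- remove2 i s] w'
  | (i, Cross _) :: w' => components_from fresh (swap2 0 i s) w'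
  end.

Definition components (w : word) : nat := components_from 0 [::] w.

Record diagram := Diagram {
  pieces :> seq piece;
  diagram_closed : run [::] pieces = Some [::];
  diagram_one_component : components pieces = 1
}.

(* Exchanges left and right ends of a crossing: the same over strand now runs
   along the other diagonal.  On real crossings this is also the effect of
   switching over and under. *)
Definition flip (c : crossing) : crossing :=
  if c is Real b then Real (~~ b) else Virtual.

(* Planar isotopy of diagrams in general position: far-apart pieces change
   their relative heights, a local minimum and a local maximum cancel, and a
   double point slides through a local extremum.  In the last two rules the
   strand that was on the bottom-left-to-top-right diagonal moves to the other
   one, whence [flip]. *)
Inductive isotopy_rule : word -> word -> Prop :=
| Exchange i j g h : i <= j ->
    isotopy_rule [:: (i, g); (j + top_ends g, h)]
                 [:: (j + bottom_ends g, h); (i, g)]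
| ZigzagR i up : isotopy_rule [:: (i, Cup up); (i.+1, Cap)] [::]
| ZigzagL i up : isotopy_rule [:: (i.+1, Cup up); (i, Cap)] [::]
| SlideCup i up c :
    isotopy_rule [:: (i.+1, Cup up); (i, Cross c)]
                 [:: (i, Cup up); (i.+1, Cross (flip c))]
| SlideCap i c :
    isotopy_rule [:: (i, Cross c); (i.+1, Cap)]
                 [:: (i.+1, Cross (flip c)); (i, Cap)].

(* A vertical strand with a curl to its right, resp. to its left. *)
Definition curlR (i : nat) (up : bool) (c : crossing) : word :=
  [:: (i.+1, Cup up); (i, Cross c); (i.+1, Cap)].
Definition curlL (i : nat) (up : bool) (c : crossing) : word :=
  [:: (i, Cup up); (i.+1, Cross c); (i, Cap)].

Definition bigon (i : nat) (c : crossing) : word :=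
  [:: (i, Cross c); (i, Cross (flip c))].

(* The two sides of a third move on strands numbered 1, 2, 3 from the left at
   the bottom, where [cjk] is the crossing of strands [j] and [k]; strand [j]
   is over strand [k] when [cjk] is [Real true] (j < k). *)
Definition triangle_bot (i : nat) (c12 c13 c23 : crossing) : word :=
  [:: (i, Cross c12); (i.+1, Cross c13); (i, Cross c23)].
Definition triangle_top (i : nat) (c12 c13 c23 : crossing) : word :=
  [:: (i.+1, Cross c23); (i, Cross c13); (i.+1, Cross c12)].

(* In [RIII] the hypothesis excludes the two cyclic over/under patterns, in
   which the strands do not lie at three distinct heights.  The three cases of
   [VRIV] say which strand is the one with only virtual crossings. *)
Inductive reidemeister_rule : word -> word -> Prop :=
| RI_R i up b : reidemeister_rule (curlR i up (Real b)) [::]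
| RI_L i up b : reidemeister_rule (curlL i up (Real b)) [::]
| RII i b : reidemeister_rule (bigon i (Real b)) [::]
| RIII i b12 b13 b23 : (b12 = b23 -> b13 = b12) ->
    reidemeister_rule (triangle_bot i (Real b12) (Real b13) (Real b23))
                      (triangle_top i (Real b12) (Real b13) (Real b23))
| VRI_R i up : reidemeister_rule (curlR i up Virtual) [::]
| VRI_L i up : reidemeister_rule (curlL i up Virtual) [::]
| VRII i : reidemeister_rule (bigon i Virtual) [::]
| VRIII i : reidemeister_rule (triangle_bot i Virtual Virtual Virtual)
                              (triangle_top i Virtual Virtual Virtual)
| VRIV_1 i b : reidemeister_rule (triangle_bot i Virtual Virtual (Real b))
                                 (triangle_top i Virtual Virtual (Real b))
| VRIV_2 i b : reidemeister_rule (triangle_bot i Virtual (Real b) Virtual)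
                                 (triangle_top i Virtual (Real b) Virtual)
| VRIV_3 i b : reidemeister_rule (triangle_bot i (Real b) Virtual Virtual)
                                 (triangle_top i (Real b) Virtual Virtual).

Definition move (D E : diagram) : Prop :=
  exists u l r v : word,
    [/\ pieces D = u ++ l ++ v, pieces E = u ++ r ++ v
      & isotopy_rule l r \/ reidemeister_rule l r].

Definition equivalent : diagram -> diagram -> Prop :=
  clos_refl_sym_trans diagram move.

Record virtual_knot := VirtualKnot {
  presents : diagram -> Prop;
  presents_class : exists D, forall E, presents E <-> equivalent D E
}.

Definition is_crossing (p : piece) : bool :=
  if p.2 is Cross _ then true else false.

(* A diagram with neither real nor virtual crossings presents the trivial
   knot. *)
Definition presents_trivial_knot (D : diagram) : Prop :=
  exists2 E : diagram, equivalent D E & ~~ has is_crossing E.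

(* [altered m n w w']: w' arises from w by making m real crossings virtual and
   switching over and under at n other real crossings. *)
Inductive altered : nat -> nat -> word -> word -> Prop :=
| altered_nil : altered 0 0 [::] [::]
| altered_keep p m n w w' : altered m n w w' -> altered m n (p :: w) (p :: w')
| altered_virtualize i b m n w w' : altered m n w w' ->
    altered m.+1 n ((i, Cross (Real b)) :: w) ((i, Cross Virtual) :: w')
| altered_switch i b m n w w' : altered m n w w' ->
    altered m n.+1 ((i, Cross (Real b)) :: w) ((i, Cross (Real (~~ b))) :: w').

Definition unknottable (D : diagram) (mn : nat * nat) : Prop :=
  exists2 D' : diagram, altered mn.1 mn.2 D D' & presents_trivial_knot D'.

(* [*l] is the lexicographic product order. *)
Definition is_lex_min (S : nat * nat -> Prop) (p : nat * nat) : Prop :=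
  S p /\ forall q, S q -> ((p : nat *l nat) <= q)%O.

(* U(D) = p *)
Definition diagram_index (D : diagram) (p : nat * nat) : Prop :=
  is_lex_min (unknottable D) p.

(* U(K) = p *)
Definition unknotting_index (K : virtual_knot) (p : nat * nat) : Prop :=
  is_lex_min (fun q => exists2 D, presents K D & diagram_index D q) p.

(* Main.v *)
From Stdlib Require Import Relation_Operators.
From mathcomp Require Import all_boot all_order all_algebra.
From mathcomp Require Import zify.
Require Import Defs.

Set Implicit Arguments.
Unset Strict Implicit.
Unset Printing Implicit Defensive.

Import GRing.Theory Num.Theory.

(** The knot is the closure of n copies of the virtual trefoil (two real
    crossings and a virtual one on two parallel strands) placed along one
    strand.  Switching one real crossing of a copy makes its two real crossings
    cancel by a second move, and the curl that remains, with a virtual crossing,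
    disappears by a virtual first move.  So n switches are enough
    ([switched_trefoils_trivial]).

    That fewer switches do not suffice, on any diagram of the knot, follows from
    the odd writhe: the sum of the signs of the real crossings whose chord in
    the Gauss diagram meets an odd number of other real chords.  It is invariant
    under all moves; a switch preserves these parities and negates one sign, so
    the odd writhe changes by 0 or 2 or -2.  It vanishes without crossings, and
    equals 2n here since all 2n real crossings are odd and positive.

    The odd writhe is made local as follows.  Colour the curve with two colours
    that change at each passage through a real crossing.  Between its two
    passages through a crossing c, the curve passes through real crossings a
    number of times that has the parity of the number of chords meeting that of
    c; hence c is odd exactly when its two strands enter with the same colour.  Recording on each strand,
    instead of its colour, the colour plus its orientation modulo 2 (its
    charge), the rules no longer mention the orientation: the two ends of a
    local extremum have opposite charges, a real crossing reverses the charges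
    of both strands, and it is odd when the two strands below it have equal
    charges.

    Each colouring of a word thus has a weight, a sum over pieces, and the move
    invariance becomes a bijection between the colourings of the two sides of
    each rule ([isotopy_colourings], [reidemeister_colourings]).  Working with
    the set of the weights of all colourings avoids proving that a knot diagram
    has a colouring and that it is unique up to reversing the two colours: the
    trivial diagram has a colouring of weight 0 ([trivial_weight]), the moves
    and the switches transport it ([equivalent_weight], [altered_weight]) to a
    colouring of the knot above, all of whose colourings have weight 2n
    ([trefoils_weight]). *)

(** * Charges and coloured words *)

(** Orientation ([true] = upwards) and charge. *)
Definition strand := (bool * bool)%type.
Definition state := seq strand.
Definition orientations (s : state) : seq bool := [seq x.1 | x <- s].
Definition opposite (x : strand) : strand := (~~ x.1, ~~ x.2).
Definition recharge (x : strand) : strand := (x.1, ~~ x.2).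

(** With both strands upwards, [Real true] is the positive crossing; reversing
    one of the strands negates the sign. *)
Definition sign (b : bool) (x y : strand) : int :=
  if b == (x.1 == y.1) then 1%R else (-1)%R.

(** The share of a real crossing in the odd writhe. *)
Definition contribution (b : bool) (x y : strand) : int :=
  if x.2 == y.2 then sign b x y else 0%R.

(** The possible states above a piece with no strand to its left, with the
    contribution of the piece.  The only choice is the colour of a new arc. *)
Definition colour_leftmost (g : shape) (s : state) : seq (state * int) :=
  match g, s with
  | Cup up, _ =>
      [seq ([:: (up, c), opposite (up, c) & s], 0%R) | c <- [:: true; false]]
  | Cap, x :: y :: q => if y == opposite x then [:: (q, 0%R)] else [::]
  | Cross (Real b), x :: y :: q =>
      [:: ([:: recharge y, recharge x & q], contribution b x y)]
  | Cross Virtual, x :: y :: q => [:: ([:: y, x & q], 0%R)]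
  | _, _ => [::]
  end.

Definition prepend (x : strand) (o : state * int) : state * int :=
  (x :: o.1, o.2).

(** Recursion on the position makes strands to the left inert by computation;
    the local study of a move then takes place at position 0. *)
Fixpoint colour_piece (i : nat) (g : shape) (s : state) : seq (state * int) :=
  match i, s with
  | 0, _ => colour_leftmost g s
  | i'.+1, x :: q => map (prepend x) (colour_piece i' g q)
  | _.+1, [::] => [::]
  end.

Fixpoint colourings (s : state) (w : word) : seq (state * int) :=
  if w is (i, g) :: w' then
    [seq (o'.1, (o.2 + o'.2)%R) | o <- colour_piece i g s,
                                  o' <- colourings o.1 w']
  else [:: (s, 0%R)].

Lemma colourings_consP s i g w t v :
  reflect (exists m a b, [/\ (m, a) \in colour_piece i g s,
                             (t, b) \in colourings m w & v = (a + b)%R])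
          ((t, v) \in colourings s ((i, g) :: w)).
Proof.
apply: (iffP allpairsPdep) => [[[m a] [[t' b] [/= h1 h2 [-> ->]]]] | ].
  by exists m, a, b.
by case=> m [a [b [h1 h2 ->]]]; exists (m, a), (t, b).
Qed.

Lemma colourings_catP s u w t v :
  reflect (exists m a b, [/\ (m, a) \in colourings s u,
                             (t, b) \in colourings m w & v = (a + b)%R])
          ((t, v) \in colourings s (u ++ w)).
Proof.
elim: u s t v => [|[i g] u IH] s t v.
  apply: (iffP idP) => [h | [m [a [b [h hb ->]]]]].
    by exists s, 0%R, v; rewrite inE eqxx add0r.
  by move: h; rewrite inE => /eqP [<- ->]; rewrite add0r.
rewrite cat_cons; apply: (iffP (colourings_consP _ _ _ _ _ _)).
  case=> m [a [b [h1 /IH [m' [a' [b' [h2 h3 ->]]]] ->]]].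
  exists m', (a + a')%R, b'; rewrite addrA; split=> //.
  by apply/colourings_consP; exists m, a, a'.
case=> m [a [b [/colourings_consP [m' [a' [b' [h1 h2 ->]]]] h3 ->]]].
exists m', a', (b' + b)%R; rewrite addrA; split=> //.
by apply/IH; exists m, b', b.
Qed.

(** * Words moved to the right *)

Definition lift (w : word) : word := [seq (p.1.+1, p.2) | p <- w].

Lemma colourings_lift x s w :
  colourings (x :: s) (lift w) = map (prepend x) (colourings s w).
Proof.
elim: w s => [|[i g] w IH] s //=.
rewrite allpairs_mapl map_flatten -map_comp; congr flatten.
by apply: eq_map => o /=; rewrite IH -!map_comp.
Qed.

Lemma step_cons b s i g :
  step (b :: s) (i.+1, g) = omap (cons b) (step s (i, g)).
Proof. by case: g => [up||c] /=; rewrite ltnS; case: ifP. Qed.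

Lemma run_cons s p w : run s (p :: w) = obind (run^~ w) (step s p).
Proof.
rewrite /run /=; case: (step s p) => //=.
by elim: w => //= p' w.
Qed.

Lemma run_cat s u w : run s (u ++ w) = obind (run^~ w) (run s u).
Proof.
elim: u s => [|p u IH] s //.
by rewrite cat_cons !run_cons; case: (step s p) => //=.
Qed.

Lemma run_lift b s w : run (b :: s) (lift w) = omap (cons b) (run s w).
Proof.
elim: w s => [|[i g] w IH] s //.
by rewrite /lift /= -/(lift w) !run_cons step_cons; case: (step s _) => //=.
Qed.

Lemma colour_piece_step i g s o :
  o \in colour_piece i g s ->
  step (orientations s) (i, g) = Some (orientations o.1).
Proof.
elim: i s o => [|i IH] [|x s] o //.
- by case: g => [up||[b|]] //; rewrite /= !inE; case/orP=> /eqP ->.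
- case: g => [up||[b|]] /=.
  + by rewrite !inE; case/orP=> /eqP ->.
  + case: s => [|y q] //; case: eqP => // ->; rewrite inE => /eqP -> /=.
    by case: x.1 => /=; rewrite /remove2 /= ?take0 drop0.
  + case: s => [|y q] //; rewrite inE => /eqP -> /=.
    by rewrite /swap2 /insert2 /remove2 /= ?take0 ?drop0.
  + case: s => [|y q] //; rewrite inE => /eqP -> /=.
    by rewrite /swap2 /insert2 /remove2 /= ?take0 ?drop0.
- case/mapP=> o' /IH h ->.
  by rewrite [orientations (x :: s)]/= step_cons h.
Qed.

Lemma colourings_run s w t v :
  (t, v) \in colourings s w -> run (orientations s) w = Some (orientations t).
Proof.
elim: w s t v => [|[i g] w IH] s t v; first by rewrite inE => /eqP [-> _].
case/colourings_consP=> m [a [b [/colour_piece_step h /IH h2 _]]].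
by rewrite run_cons h /= h2.
Qed.

(** * Invariance under the moves *)

(** A move may erase pieces, and the shorter side then accepts states that have
    too few strands, or the wrong orientations, for the longer one.  Inside a
    diagram both sides fit, which is what the two hypotheses express. *)
Definition same_colourings (l r : word) : Prop :=
  forall s, run (orientations s) l -> run (orientations s) r ->
  colourings s l =i colourings s r.

Lemma same_colourings_lift l r :
  same_colourings l r -> same_colourings (lift l) (lift r).
Proof.
move=> h [|x s]; last first.
  rewrite /= !run_lift => hl hr o; rewrite !colourings_lift.
  have e : colourings s l =i colourings s r.
    by apply: h; [case: (run _ l) hl | case: (run _ r) hr].
  by apply/mapP/mapP=> -[o' ho ->]; exists o'; rewrite // ?e // -e.
by case: l r {h} => [|[i [?||?]] l] [|[j [?||?]] r] //; rewrite run_cons.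
Qed.

Lemma leftmost_cat g a b q v :
  (b, v) \in colour_leftmost g a -> (b ++ q, v) \in colour_leftmost g (a ++ q).
Proof.
case: g => [up||[c|]]; case: a => [|x [|y a]] //=; rewrite ?inE.
- by case/orP=> /eqP [-> ->]; rewrite eqxx ?orbT.
- by case/orP=> /eqP [-> ->]; rewrite eqxx ?orbT.
- by case/orP=> /eqP [-> ->]; rewrite eqxx ?orbT.
- by case: eqP => // _; rewrite !inE => /eqP [-> ->].
- by case/eqP=> -> ->.
- by case/eqP=> -> ->.
Qed.

Lemma leftmost_split g s t v :
  (t, v) \in colour_leftmost g s ->
  exists a b q, [/\ s = a ++ q, t = b ++ q, size a = bottom_ends g,
                    size b = top_ends g & (b, v) \in colour_leftmost g a].
Proof.
case: g => [up||c].
- rewrite /= !inE; case/orP=> /eqP [-> ->].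
    by exists [::], [:: (up, true); opposite (up, true)], s; rewrite !inE eqxx.
  exists [::], [:: (up, false); opposite (up, false)], s.
  by rewrite !inE eqxx orbT.
- case: s => [|x [|y s]] //=; case: eqP => // ->; rewrite inE => /eqP [-> ->].
  by exists [:: x; opposite x], [::], s; rewrite /= eqxx.
- case: c => [c|]; case: s => [|x [|y s]] //=; rewrite inE => /eqP [-> ->].
    exists [:: x; y], [:: recharge y; recharge x], s.
    by split=> //; rewrite inE.
  by exists [:: x; y], [:: y; x], s; split=> //; rewrite inE.
Qed.

Lemma colour_piece_catP a j g s t v :
  reflect (exists2 t', t = a ++ t' & (t', v) \in colour_piece j g s)
          ((t, v) \in colour_piece (size a + j) g (a ++ s)).
Proof.
elim: a t v => [|x a IH] t v /=.
  by apply: (iffP idP) => [h | [t' ->]]; first exists t.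
apply: (iffP mapP) => [[[m w] h [-> ->]] | [t' -> h]].
  by case/IH: h => t' -> h; exists t'.
by exists (a ++ t', v) => //; apply/IH; exists t'.
Qed.

Lemma colour_piece_size i g s o : o \in colour_piece i g s -> i <= size s.
Proof.
elim: i s o => [|i IH] [|x s] //= o.
by rewrite ltnS; case/mapP=> o' /IH.
Qed.

Lemma colourings2P s i g j h t v :
  reflect (exists m a b, [/\ (m, a) \in colour_piece i g s,
                             (t, b) \in colour_piece j h m & v = (a + b)%R])
          ((t, v) \in colourings s [:: (i, g); (j, h)]).
Proof.
apply: (iffP (colourings_consP _ _ _ _ _ _)).
  case=> m [a [b [h1 /colourings_consP [m' [a' [b' [h2 h3 ->]]]] ->]]].
  move: h3; rewrite inE => /eqP [-> ->].
  by exists m, a, a'; rewrite addr0.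
case=> m [a [b [h1 h2 ->]]]; exists m, a, b; split=> //.
by apply/colourings_consP; exists t, b, 0%R; rewrite inE eqxx addr0.
Qed.

(** Pieces with disjoint supports act on disjoint segments of the state. *)
Lemma exchange_colourings j g h s :
  colourings s [:: (0, g); (j + top_ends g, h)]
    =i colourings s [:: (j + bottom_ends g, h); (0, g)].
Proof.
move=> [t v]; apply/colourings2P/colourings2P.
  case=> m [x [y [/leftmost_split [a [b [q [-> -> sa sb hg]]]]]]].
  rewrite -sb -sa ![j + _]addnC => /colour_piece_catP [q' -> hh] ->.
  exists (a ++ q'), y, x; rewrite addrC; split=> //; last exact: leftmost_cat.
  by apply/colour_piece_catP; exists q'.
case=> m [y [x [hh hg ->]]].
have sz : bottom_ends g <= size s.
  by apply: leq_trans (colour_piece_size hh); apply: leq_addl.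
have sa : size (take (bottom_ends g) s) = bottom_ends g by exact: size_takel.
move: hh; rewrite -{1}[s](cat_take_drop (bottom_ends g)) -{1}sa addnC.
case/colour_piece_catP=> q' Em hh; move: hg; rewrite Em.
case/leftmost_split=> a [b [q [/eqP Es -> sa' sb hg]]].
move: Es; rewrite eqseq_cat ?sa ?sa' // => /andP [/eqP Ea /eqP Eq].
exists (b ++ drop (bottom_ends g) s), x, y; rewrite addrC; split=> //.
  by rewrite -{2}[s](cat_take_drop (bottom_ends g)) Ea; apply: leftmost_cat.
by rewrite -sb addnC; apply/colour_piece_catP; exists q'; rewrite -?Eq.
Qed.

(** The remaining rules involve at most three strands.  At position 0 their
    colourings are found by computation, once the orientations, charges and
    signs are given concrete values. *)
Ltac eval_run :=
  rewrite !run_cons;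
  do 3 rewrite /= ?run_cons /= /insert2 /remove2 /swap2 /= ?take0 ?drop0.
Ltac to_left_edge i :=
  let IH := fresh in elim: i => [|i IH]; last exact: same_colourings_lift IH.

Lemma isotopy_colourings l r : isotopy_rule l r -> same_colourings l r.
Proof.
case=> {l r}.
- move=> i j g h; elim: i j => [|i IH] [|j] // le_ij.
  + by move=> s _ _; apply: exchange_colourings.
  + by move=> s _ _; apply: exchange_colourings.
  + exact: same_colourings_lift (IH j le_ij).
- move=> i up; to_left_edge i.
  case=> [|[o c] q] //; eval_run.
  by case: o up c => [] [] [].
- move=> i up; to_left_edge i.
  case=> [|[o c] q] //; eval_run.
  by case: o up c => [] [] [].
- move=> i up c; to_left_edge i.
  move=> [|[o d] q] _ _ [t v]; first by case: c.
  by case: c o up d => [[]|] [] [] []; rewrite /= !inE // orbC.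
- move=> i c; to_left_edge i.
  case: c => [b|] [|[o d] [|[o' d'] [|[o'' d''] q]]] _ _ //.
  + by case: b o d o' d' o'' d'' => [] [] [] [] [] [] [].
  + by case: o d o' d' o'' d'' => [] [] [] [] [] [].
Qed.

(** In a real first move the cap forces unequal charges at the crossing, which
    is therefore even; in a second move the signs are opposite and the parities
    equal.  In a third move the crossing of two strands has the same parity on
    both sides: either both charges have been reversed by the third strand on
    one side and none on the other, or one charge is reversed on each side. *)
Lemma reidemeister_colourings l r :
  reidemeister_rule l r -> same_colourings l r.
Proof.
case=> {l r}.
- move=> i up b; to_left_edge i.
  case=> [|[o c] q] //; eval_run.
  by case: o up c b => [] [] [] [].
- move=> i up b; to_left_edge i.
  case=> [|[o c] q] //; eval_run.
  by case: o up c b => [] [] [] [].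
- move=> i b; to_left_edge i.
  case=> [|[o c] [|[o' c'] q]] //.
  by case: b o c o' c' => [] [] [] [] [].
- move=> i b12 b13 b23 _; to_left_edge i.
  case=> [|[o c] [|[o' c'] [|[o'' c''] q]]] //.
  by case: b12 b13 b23 o c o' c' o'' c'' => [] [] [] [] [] [] [] [] [].
- move=> i up; to_left_edge i.
  case=> [|[o c] q] //; eval_run.
  by case: o up c => [] [] [].
- move=> i up; to_left_edge i.
  case=> [|[o c] q] //; eval_run.
  by case: o up c => [] [] [].
- move=> i; to_left_edge i.
  by case=> [|x [|y q]].
- move=> i; to_left_edge i.
  by case=> [|x [|y [|z q]]].
- move=> i b; to_left_edge i.
  by case=> [|x [|y [|z q]]] //= _ _ o; rewrite !add0r !addr0.
- move=> i b; to_left_edge i.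
  by case=> [|x [|y [|z q]]] //= _ _ o; rewrite !add0r !addr0.
- move=> i b; to_left_edge i.
  by case=> [|x [|y [|z q]]] //= _ _ o; rewrite !add0r !addr0.
Qed.

(** * The weights of a diagram *)

Definition colouring_weight (w : word) (v : int) : Prop :=
  ([::], v) \in colourings [::] w.

Lemma same_colourings_in_context u l r v x :
  same_colourings l r ->
  run [::] (u ++ l ++ v) = Some [::] -> run [::] (u ++ r ++ v) = Some [::] ->
  colouring_weight (u ++ l ++ v) x <-> colouring_weight (u ++ r ++ v) x.
Proof.
move=> h; rewrite !run_cat; case Eu: (run [::] u) => [s|//] /=.
rewrite !run_cat.
case El: (run s l) => [//|//] _; case Er: (run s r) => [//|//] _.
have same m a : (m, a) \in colourings [::] u ->
    colourings m l =i colourings m r.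
  by move/colourings_run; rewrite Eu => -[Es]; apply: h; rewrite -Es ?El ?Er.
split=> /colourings_catP [m [a [b [hu /colourings_catP
    [m' [a' [b' [hl hv Eb]]]] ->]]]]; apply/colourings_catP;
  exists m, a, b; split=> //; apply/colourings_catP; exists m', a', b';
  by rewrite ?(same _ _ hu) // -(same _ _ hu).
Qed.

Lemma equivalent_weight (D E : diagram) x :
  equivalent D E -> colouring_weight D x <-> colouring_weight E x.
Proof.
elim=> {D E} [D E | D | D E _ | D E F _ IH1 _ IH2] //.
- case=> u [l [r [v [ED EE h]]]].
  have := diagram_closed D; have := diagram_closed E; rewrite ED EE => cE cD.
  apply: same_colourings_in_context => //.
  by case: h; [apply: isotopy_colourings | apply: reidemeister_colourings].
- by move=> h; rewrite h.
- by rewrite IH1.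
Qed.

(** Without crossings the constant colour 0 is allowed, which makes the charge
    of every strand equal to its orientation. *)
Definition diagonal (s : seq bool) : state := [seq (b, b) | b <- s].

Lemma step_diagonal s i g s' :
  ~~ is_crossing (i, g) -> step s (i, g) = Some s' ->
  (diagonal s', 0%R) \in colour_piece i g (diagonal s).
Proof.
elim: i s s' => [|i IH] [|b s] s' hg.
- by case: g hg => // up _ [<-]; case: up; rewrite !inE.
- case: g hg => // [up|] _ /=.
    by case=> <-; rewrite /insert2 /= !inE; case: up; rewrite eqxx ?orbT.
  case: s => [|b' s] //=; case: ifP => // hb [<-].
  rewrite /remove2 /= drop0 /opposite /=.
  by case: b b' hb => [] [] //=; rewrite inE.
- by case: g {IH} hg.
- rewrite step_cons; case E: (step s (i, g)) => [t|] //= -[<-].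
  by apply/mapP; exists (diagonal t, 0%R) => //; apply: IH.
Qed.

Lemma run_diagonal s w s' :
  ~~ has is_crossing w -> run s w = Some s' ->
  (diagonal s', 0%R) \in colourings (diagonal s) w.
Proof.
elim: w s => [|[i g] w IH] s; first by move=> _ [->]; rewrite inE.
rewrite /= negb_or run_cons => /andP [hg hw].
case E: (step s (i, g)) => [t|//] h.
apply/colourings_consP; exists (diagonal t), 0%R, 0%R; split=> //.
  exact: step_diagonal.
exact: IH.
Qed.

Lemma trivial_weight (D : diagram) :
  presents_trivial_knot D -> colouring_weight D 0.
Proof.
case=> E hE hc; apply/(equivalent_weight _ hE).
exact: run_diagonal hc (diagram_closed E).
Qed.

(** Charges do not see which strand is over, so a switch only changes a sign. *)
Lemma colour_piece_switch i b s t v :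
  (t, v) \in colour_piece i (Cross (Real (~~ b))) s ->
  exists2 v', (t, v') \in colour_piece i (Cross (Real b)) s
            & (`|v' - v| <= 2%:Z)%R.
Proof.
elim: i s t v => [|i IH] [|x s] t v //.
  case: s => [|y s] //; rewrite inE => /eqP [-> ->].
  exists (contribution b x y); first by rewrite inE.
  by rewrite /contribution /sign; case: eqP => //; case: b; case: (x.1 == y.1).
case/mapP=> -[m w] /IH [v' h h'] [-> ->]; exists v' => //.
by apply/mapP; exists (m, v').
Qed.

Lemma altered_weight m k w w' s t v :
  altered m k w w' -> m = 0 -> (t, v) \in colourings s w' ->
  exists2 v', (t, v') \in colourings s w & (`|v' - v| <= (k.*2)%:Z)%R.
Proof.
move=> h; elim: h s t v => {m k w w'}
  [|[i g] m k w w' _ IH|//|i b m k w w' _ IH] s t v em.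
- by move=> h; exists v => //; rewrite subrr.
- case/colourings_consP=> n [a [c [h /(IH _ _ _ em) [c' h' hc] ->]]].
  exists (a + c')%R; first by apply/colourings_consP; exists n, a, c'.
  by lia.
- case/colourings_consP=> n [a [c [/colour_piece_switch [a' h ha]]]].
  case/(IH _ _ _ em)=> c' h' hc ->.
  exists (a' + c')%R; first by apply/colourings_consP; exists n, a', c'.
  by lia.
Qed.

(** * Chains of virtual trefoils *)

(** A virtual trefoil inserted in the strand at position 0; [b = false] is the
    effect of switching its second real crossing. *)
Definition trefoil (b : bool) : word :=
  [:: (1, Cup true); (0, Cross (Real true)); (0, Cross (Real b));
      (0, Cross Virtual); (1, Cap)].

Definition trefoils (b : bool) (n : nat) : word := flatten (nseq n (trefoil b)).

Definition closed_word (w : word) : word := (0, Cup true) :: w ++ [:: (0, Cap)].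

(** A piece of knot on an upward strand at position 0, with the returning
    downward strand at its right.  The label 0 is carried by both strands
    because they are joined below; only a positive [fresh] is then unused. *)
Definition long_diagram (w : word) : Prop :=
  run [:: true; false] w = Some [:: true; false] /\
  forall fresh w', 0 < fresh -> exists2 fresh', 0 < fresh' &
    components_from fresh [:: 0; 0] (w ++ w')
      = components_from fresh' [:: 0; 0] w'.

Lemma long_diagram_nil : long_diagram [::].
Proof. by split=> // fresh w' h; exists fresh. Qed.

Lemma long_diagram_cat u w :
  long_diagram u -> long_diagram w -> long_diagram (u ++ w).
Proof.
move=> [ru cu] [rw cw]; split; first by rewrite run_cat ru.
move=> fresh w' h; rewrite -catA.
have [f1 h1 ->] := cu fresh (w ++ w') h.
exact: cw.
Qed.

Lemma long_diagram_trefoil b : long_diagram (trefoil b).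
Proof. by split=> [|[|f] w'] // _; exists f.+2; rewrite /= ?eqxx. Qed.

Lemma long_diagram_curl : long_diagram (curlR 0 true Virtual).
Proof. by split=> [|[|f] w'] // _; exists f.+2; rewrite /= ?eqxx. Qed.

Lemma long_diagram_trefoils b n : long_diagram (trefoils b n).
Proof.
elim: n => [|n IH]; first exact: long_diagram_nil.
exact: long_diagram_cat (long_diagram_trefoil b) IH.
Qed.

Lemma closed_word_run w :
  long_diagram w -> run [::] (closed_word w) = Some [::].
Proof. by case=> h _; rewrite /closed_word run_cons /= run_cat h. Qed.

Lemma closed_word_components w :
  long_diagram w -> components (closed_word w) = 1.
Proof.
case=> _ h; rewrite /components /closed_word /=.
by have [f _ ->] := h 1 [:: (0, Cap)] isT.
Qed.

Definition closed_diagram w (h : long_diagram w) : diagram :=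
  Diagram (closed_word_run h) (closed_word_components h).

(** The cap forces the two parallel strands to enter with equal charges, so both
    real crossings are odd. *)
Lemma trefoil_weight c w t v :
  (t, v) \in colourings [:: (true, c); (false, ~~ c)] (trefoil true ++ w) ->
  exists2 v', (t, v') \in colourings [:: (true, c); (false, ~~ c)] w
            & v = (2%:Z + v')%R.
Proof.
case/colourings_catP=> m [a [b [h h' ->]]].
have E : colourings [:: (true, c); (false, ~~ c)] (trefoil true)
    = [:: ([:: (true, c); (false, ~~ c)], Posz 2)] by case: (c).
by move: h; rewrite E inE => /eqP [<- ->]; exists b.
Qed.

Lemma trefoils_weight n v :
  colouring_weight (closed_word (trefoils true n)) v -> v = Posz n.*2.
Proof.
have H c w t x :
    (t, x) \in colourings [:: (true, c); (false, ~~ c)] (trefoils true n ++ w) ->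
    exists2 x', (t, x') \in colourings [:: (true, c); (false, ~~ c)] w
              & x = ((n.*2)%:Z + x')%R.
  elim: n x => [|n IH] x; first by exists x; rewrite ?add0r.
  rewrite (_ : trefoils true n.+1 = trefoil true ++ trefoils true n) // -catA.
  case/trefoil_weight=> x' /IH [y h ->] ->; exists y => //; lia.
case/colourings_consP=> m [a [b [h h' ->]]].
have [c [Em ->]] : exists c, m = [:: (true, c); (false, ~~ c)] /\ a = 0%R.
  by move: h; rewrite !inE => /orP [] /eqP [-> ->]; [exists true | exists false].
move: h'; rewrite Em => /H [x'].
rewrite /= /opposite eqxx /= inE => /eqP [->] ->.
by rewrite addr0 add0r.
Qed.

Lemma trefoils_altered n : altered 0 n (trefoils true n) (trefoils false n).
Proof.
elim: n => [|n IH]; first exact: altered_nil.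
by do 2 apply: altered_keep; apply: altered_switch; do 2 apply: altered_keep.
Qed.

Lemma altered_cat m k w w' u :
  altered m k w w' -> altered m k (w ++ u) (w' ++ u).
Proof.
elim=> {m k w w'} /=.
- by elim: u => [|p u IH]; [apply: altered_nil | apply: altered_keep].
- by move=> *; apply: altered_keep.
- by move=> *; apply: altered_virtualize.
- by move=> *; apply: altered_switch.
Qed.

(** Taking the empty chain, rather than another diagram with the same word, as
    the trivial diagram spares an identification of the proofs it contains. *)
Lemma switched_trefoils_trivial n :
  presents_trivial_knot (closed_diagram (long_diagram_trefoils false n)).
Proof.
exists (closed_diagram (long_diagram_trefoils false 0)) => //.
elim: n => [|n IH]; first exact: rst_refl.
pose curled := closed_diagram (long_diagram_cat long_diagram_curl
                                      (long_diagram_trefoils false n)).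
apply: rst_trans IH; apply: (@rst_trans _ _ _ curled); apply: rst_step.
  exists [:: (0, Cup true); (1, Cup true)], (bigon 0 (Real true)), [::].
  exists [:: (0, Cross Virtual), (1, Cap) & trefoils false n ++ [:: (0, Cap)]].
  by split=> //; right; apply: RII.
exists [:: (0, Cup true)], (curlR 0 true Virtual), [::].
by exists (trefoils false n ++ [:: (0, Cap)]); split=> //; right; apply: VRI_R.
Qed.

Lemma trefoils_unknottable n :
  unknottable (closed_diagram (long_diagram_trefoils true n)) (0, n).
Proof.
exists (closed_diagram (long_diagram_trefoils false n)).
  by apply: altered_keep; apply: altered_cat; apply: trefoils_altered.
exact: switched_trefoils_trivial.
Qed.

(** Pairs with a positive first entry are larger in the dictionary order, so the
    odd writhe is needed only when no crossing is made virtual. *)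
Lemma trefoils_unknottable_bound n (D : diagram) q :
  equivalent (closed_diagram (long_diagram_trefoils true n)) D ->
  unknottable D q ->
  (((0, n) : nat *l nat) <= q)%O.
Proof.
move=> hD [D' ha /trivial_weight h0].
case: q ha => [[|m] k] /= ha; last by [].
have [v hv hk] := altered_weight ha (erefl _) h0.
have /trefoils_weight Ev := (equivalent_weight v hD).2 hv.
rewrite Order.ProdLexiOrder.leEprodlexi.
move: hk; rewrite Ev !leEnat /=; lia.
Qed.

Theorem proposition5p4 (n : nat) :
  exists K : virtual_knot, unknotting_index K (0, n).
Proof.
pose D := closed_diagram (long_diagram_trefoils true n).
have classD :
  exists D', forall E, equivalent D E <-> equivalent D' E by exists D.
exists (VirtualKnot classD); split.
  exists D; first exact: rst_refl.
  split; first exact: trefoils_unknottable.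
  by move=> q; apply: trefoils_unknottable_bound; apply: rst_refl.
by move=> q [E hE [hq _]]; apply: trefoils_unknottable_bound hE hq.
Qed.
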